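(* Let $G$ be a countable group (not necessarily amenable), and let $X$ be a $G$-subshift. Let $S \subset G$ and $T \subset G$ be finite, and let $1 \leq k \leq |S|$. Then there exists a clopen set $F \subset X$ such that (1) the collection $\{ \sigma^s(F) : s \in S \}$ is $(k+1)$-fold disjoint, and (2) if $x \in X$ satisfies $x \notin \bigcup_{s \in S^{-1} S} \sigma^s(F)$, then $x(T)$ has $k$ periods from $S^{-1} S$.
   Context: For a finite alphabet $\mathcal{A}$, the shift action on $\mathcal{A}^G$ is $(\sigma^g(x))(h) = x(hg)$; a $G$-subshift is a closed $\sigma$-invariant subset of $\mathcal{A}^G$ (product topology) for some finite alphabet $\mathcal{A}$. $x(T)\in\mathcal{A}^T$ is the restriction of $x$ to $T$. $S^{-1}S=\{s^{-1}t: s,t\in S\}$. The number $k$ is an integer. A finite collection $\mathcal{F}$ of sets is $k$-fold disjoint, for $k\in\mathbb{N}$, if for all collections $\{F_1,\dots,F_k\}$ of $k$ distinct elements of $\mathcal{F}$, $\bigcap_{\ell=1}^k F_\ell=\varnothing$. For $P\subset G$ finite, $T\subset G$, $k\in\mathbb{N}$ and $w\in\mathcal{A}^T$, $w$ has $k$ periods from $P$ if there are $k$ distinct elements $p_1,\dots,p_k\in P$ such that for each $i$, $w_g=w_{gp_i}$ whenever $g$ and $gp_i$ are both in $T$. *)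

(* Defs.v *)
From mathcomp Require Import all_boot finmap.
From mathcomp Require Import all_classical topology function_spaces.

Set Implicit Arguments.
Unset Strict Implicit.
Unset Printing Implicit Defensive.

Local Open Scope fset_scope.
Local Open Scope classical_set_scope.
Local Open Scope group_scope.

Definition full_shift (G : groupType) (A : finType) : Type :=
  prod_topology (fun _ : G => discrete_topology A).

Definition sigma (G : groupType) (A : finType) (g : G) (x : full_shift G A) :
  full_shift G A := fun h => x (h * g).

Definition subshift (G : groupType) (A : finType) (X : set (full_shift G A)) :
  Prop := closed X /\ forall g, sigma g @` X `<=` X.

(* [subspace X] also contains the points outside X, each of them isolated, so
   for F inside X being clopen there is being clopen in the subspace X. *)
Definition clopen_in (T : topologicalType) (X F : set T) : Prop :=
  F `<=` X /\ clopen (F : set (subspace X)).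

(* Collections of sets are indexed families and "distinct" refers to indices:
   F i and F j count twice when i != j even if they are equal as sets. *)
Definition kfold_disjoint (I : choiceType) (T : Type) (k : nat) (J : {fset I})
    (F : I -> set T) : Prop :=
  forall K : {fset I}, (K `<=` J)%fset -> #|` K| = k ->
    \bigcap_(i in [set` K]) F i = set0.

Definition restriction (G : groupType) (A : finType) (T : set G)
  (x : full_shift G A) : T -> A := fun t => x (\val t).

Definition has_periods (G : groupType) (A : finType) (k : nat) (P : {fset G})
    (T : set G) (w : T -> A) : Prop :=
  exists Q : {fset G}, [/\ (Q `<=` P)%fset, #|` Q| = k &
    forall p, p \in Q -> forall g h : T, \val h = \val g * p -> w g = w h].

Definition invmul (G : groupType) (S : {fset G}) : {fset G} :=
  [fset s^-1 * t | s in S, t in S]%fset.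

(* Main.v *)
Require Import Defs.
From mathcomp Require Import all_boot finmap.
From mathcomp Require Import all_classical topology function_spaces.

Local Open Scope classical_set_scope.

(** Call a pattern on [T] bad if it does not have [k] periods from [S^-1 S].
    If [k + 1] translates by elements of [S] of the cylinder of a pattern [w]
    meet, comparing one of them with the [k] others gives [k] periods of [w];
    so the translates of a bad cylinder are [(k+1)]-fold disjoint.  Enumerate the
    finitely many bad cylinders [U_1, ..., U_n] and put
    [F_(j+1) = F_j `|` (U_(j+1) minus the union of the translates of F_j by
    S^-1 S)].  The removed part makes every translate of [F_j] by [S] disjoint
    from every translate of the new piece by [S], which preserves
    [(k+1)]-fold disjointness, and each [U_j] ends up covered. *)

Lemma clopen_bigcup (T : topologicalType) (I : choiceType) (D : set I)
    (F : I -> set T) :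
  finite_set D -> (forall i, D i -> clopen (F i)) ->
  clopen (\bigcup_(i in D) F i).
Proof.
move=> finD cF; split; first by apply: bigcup_open => i /cF[].
by apply: closed_bigcup => // i /cF[].
Qed.

Lemma clopen_bigcap (T : topologicalType) (I : choiceType) (D : set I)
    (F : I -> set T) :
  finite_set D -> (forall i, D i -> clopen (F i)) ->
  clopen (\bigcap_(i in D) F i).
Proof.
move=> finD cF; rewrite -[X in clopen X]setCK setC_bigcap.
apply: (clopenC set0); apply: clopen_bigcup => // i /cF; exact: (clopenC set0).
Qed.

Section Shift.
Variables (G : groupType) (A : finType).
Implicit Types (x y : full_shift G A) (F U : set (full_shift G A)).

Lemma sigmaM (g h : G) x : sigma g (sigma h x) = sigma (g * h)%g x.
Proof. by apply/funext => t; rewrite /sigma mulgA. Qed.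

Lemma sigma1 x : sigma 1%g x = x.
Proof. by apply/funext => t; rewrite /sigma mulg1. Qed.

Lemma image_sigmaE (g : G) F : sigma g @` F = sigma g^-1%g @^-1` F.
Proof.
apply/seteqP; split=> [_ [x Fx <-]|x Fx] /=.
  by rewrite sigmaM mulVg sigma1.
by exists (sigma g^-1%g x) => //; rewrite sigmaM mulgV sigma1.
Qed.

Lemma image_sigmaP (g : G) F x : (sigma g @` F) x <-> F (sigma g^-1%g x).
Proof. by rewrite image_sigmaE. Qed.

Lemma coordinate_continuous (h : G) :
  continuous (fun x : full_shift G A => x h).
Proof. exact: (@proj_continuous G (fun _ => discrete_topology A) h). Qed.

(** Continuity into the product is tested on each coordinate, and the coordinate [h] of [sigma g x]
    is the coordinate [h * g] of [x]. *)
Lemma sigma_continuous (g : G) : continuous (@sigma G A g).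
Proof.
move=> x; apply/cvg_sup; first exact: (@fmap_filter _ _ _ _ (nbhs_filter x)).
move=> h; move: x.
apply/(@continuousP _ (initial_topology (fun f : full_shift G A => f h))).
move=> _ [B oB <-]; rewrite -comp_preimage.
by move: (coordinate_continuous (h * g)%g) => /continuousP; apply.
Qed.

Lemma clopen_image_sigma (g : G) F : clopen F -> clopen (sigma g @` F).
Proof.
by rewrite image_sigmaE => cF; exact: preimage_clopen (@sigma_continuous _).
Qed.

Lemma clopen_in_setI (T : topologicalType) (X C : set T) :
  clopen C -> clopen_in X (X `&` C).
Proof.
move=> [oC cC]; split; first exact: subIsetl.
split; first by rewrite open_subspaceTI; exact: open_subspaceW.
by apply: closedI; [exact: closed_subspaceT|exact: closed_subspaceW].
Qed.

(** Here [T] is coerced to a finite type, so that patterns can be enumerated as finite functions;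
    [restriction] is indexed by a classical set instead, and [set_valP] helps to pass between the
    two. *)
Definition cylinder (T : {fset G}) (w : T -> A) : set (full_shift G A) :=
  [set x | forall t : T, x (\val t) = w t].

Lemma clopen_cylinder (T : {fset G}) (w : T -> A) : clopen (cylinder T w).
Proof.
rewrite (_ : cylinder T w = \bigcap_(t in [set: T]) [set x | x (\val t) = w t]).
  2: by apply/seteqP; split=> x wx t; [move=> _; exact: wx|exact: (wx t I)].
apply: clopen_bigcap => [|t _]; first exact: finite_finset.
apply: (@preimage_clopen _ (discrete_topology A) (fun x => x (\val t))
  [set w t] _ (coordinate_continuous _)).
by split; [exact: discrete_open|exact: discrete_closed].
Qed.

Lemma mem_invmul (S : {fset G}) (s t : G) :
  s \in S -> t \in S -> (s^-1 * t)%g \in invmul S.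
Proof. by move=> sS tS; apply/imfset2P; exists s => //; exists t. Qed.

Lemma cylinder_kfold_disjoint (S T : {fset G}) (k : nat) (w : T -> A) :
  (forall x, cylinder T w x ->
     ~ has_periods k (invmul S) (restriction (T := [set` T]) x)) ->
  kfold_disjoint k.+1 S (fun s => sigma s @` cylinder T w).
Proof.
move=> bad K KS cK; apply/seteqP; split=> // y /= Ky.
have /fset0Pn [s0 s0K] : (K != fset0)%fset by rewrite -cardfs_gt0 cK.
have /image_sigmaP cyl0 := Ky _ s0K.
(* Every [s] in [K] satisfies [w t = y (t * s^-1)] for [t] in [T]. If [h = g * (s^-1 * s0)], then
   [h * s0^-1 = g * s^-1], so [w] agrees at [g] and [h]. *)
apply: (bad _ cyl0); exists [fset s^-1 * s0 | s in (K `\ s0)]%fset%g; split.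
- apply/fsubsetP => _ /imfsetP[s /= /fsetD1P[_ sK] ->].
  by rewrite mem_invmul // (fsubsetP KS).
- rewrite card_imfset /=; last by move=> a b /mulIg /invg_inj.
  by move: cK; rewrite (cardfsD1 s0) s0K => -[].
- move=> _ /imfsetP[s /= /fsetD1P[_ sK] ->] g h hE.
  have Tg : \val g \in T := set_valP g.
  have Th : \val h \in T := set_valP h.
  have /image_sigmaP cyls := Ky _ sK.
  have := cyls [` Tg]%fset; rewrite -(cyl0 [` Tg]%fset) /= => e.
  by rewrite /restriction /= hE -e /sigma -mulgA mulgK.
Qed.

Lemma kfold_disjoint_sub (k : nat) (S : {fset G}) F F' : F `<=` F' ->
  kfold_disjoint k S (fun s => sigma s @` F') ->
  kfold_disjoint k S (fun s => sigma s @` F).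
Proof.
move=> FF' dF' K KS cK; rewrite -subset0 -(dF' K KS cK).
by apply: subset_bigcap => s _; exact: image_subset.
Qed.

(** If [y] lies in the translate of [F] by [s] and in that of [U] by [t], with [s] and [t] in [S],
    then [sigma t^-1 y] lies in [U] and in the translate of [F] by [t^-1 * s], which is excluded.
    Hence translates of the union that meet at [y] all do so through [F] or all through [U]. *)
Lemma kfold_disjointU (k : nat) (S : {fset G}) F U :
  (U `&` \bigcup_(s in [set` invmul S]) (sigma s @` F) = set0) ->
  kfold_disjoint k S (fun s => sigma s @` F) ->
  kfold_disjoint k S (fun s => sigma s @` U) ->
  kfold_disjoint k S (fun s => sigma s @` (F `|` U)).
Proof.
move=> UF dF dU K KS cK; apply/seteqP; split=> // y Ky.
have [[s sK Fs]|noF] := pselect (exists2 s, s \in K & F (sigma s^-1%g y)).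
- rewrite -(dF K KS cK) => t /= tK; apply/image_sigmaP.
  have /image_sigmaP[//|Ut] := Ky _ tK.
  have : set0 (sigma t^-1%g y) by rewrite -UF; split=> //; exists (t^-1 * s)%g;
    [rewrite /= mem_invmul // (fsubsetP KS)|apply/image_sigmaP;
     rewrite sigmaM invgM invgK -mulgA mulgV mulg1].
  by [].
- rewrite -(dU K KS cK) => t /= tK; apply/image_sigmaP.
  by have /image_sigmaP[Ft|//] := Ky _ tK; case: noF; exists t.
Qed.

Lemma greedy_marker (k : nat) (S : {fset G}) (I : eqType) (r : seq I)
    (U : I -> set (full_shift G A)) :
  (0 < k)%N -> S != fset0 ->
  (forall i, i \in r -> clopen (U i)) ->
  (forall i, i \in r -> kfold_disjoint k S (fun s => sigma s @` U i)) ->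
  exists C, [/\ clopen C, kfold_disjoint k S (fun s => sigma s @` C) &
    forall i, i \in r -> U i `<=` \bigcup_(s in [set` invmul S]) (sigma s @` C)].
Proof.
move=> k0 /fset0Pn[s0 s0S]; elim: r => [|i r IH] cU dU.
  exists set0; split=> //; first exact: clopen0.
  (* Since [k] is positive, the intersection runs over at least one copy of the empty set. *)
  move=> K _ cK; have /fset0Pn[s sK] : (K != fset0)%fset by rewrite -cardfs_gt0 cK.
  by apply/seteqP; split=> // y /(_ s sK) [].
have [j jr|j jr|C [cC dC UC]] := IH.
- by apply: cU; rewrite inE jr orbT.
- by apply: dU; rewrite inE jr orbT.
pose D := \bigcup_(s in [set` invmul S]) (sigma s @` C).
have DS : D `<=` \bigcup_(s in [set` invmul S]) (sigma s @` (C `|` (U i `\` D))).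
  by apply: subset_bigcup => s _; apply: image_subset => x; left.
have cD : clopen D by apply: clopen_bigcup => // s _; exact: clopen_image_sigma.
exists (C `|` (U i `\` D)); split.
- apply: clopenU => //; apply: clopenI; first by apply: cU; rewrite inE eqxx.
  exact: (clopenC set0).
- apply: kfold_disjointU => //.
    by rewrite -/D setDE -setIA setICl setI0.
  by apply: kfold_disjoint_sub (dU i _); [exact: subDsetl|rewrite inE eqxx].
- move=> j; rewrite inE => /predU1P[-> x Ux|/UC UjD]; last first.
    exact: subset_trans DS.
  have [/DS//|nDx] := pselect (D x).
  (* The new piece covers itself: [1 = s0^-1 * s0] belongs to [invmul S]. *)
  exists 1%g; first by rewrite /= -(mulVg s0) mem_invmul.
  by apply/image_sigmaP; rewrite invg1 sigma1; right.
Qed.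

End Shift.

Theorem lemma3p2 (G : groupType) (hG : countable [set: G]) (A : finType)
  (X : set (full_shift G A)) (hX : subshift X)
  (S T : {fset G}) (k : nat) (hk1 : (1 <= k)%N) (hkS : (k <= #|` S|)%N) :
  exists F : set (full_shift G A),
    [/\ clopen_in X F,
        kfold_disjoint k.+1 S (fun s => sigma s @` F) &
        forall x, X x ->
          ~ (\bigcup_(s in [set` invmul S]) (sigma s @` F)) x ->
          has_periods k (invmul S) (restriction (T := [set` T]) x)].
Proof.
have S0 : S != fset0 by rewrite -cardfs_gt0 (leq_trans hk1).
(* All points of a cylinder have the same restriction to [T], so a single point without [k] periods
   makes its pattern bad. *)
pose bad (w : {ffun T -> A}) := `[< forall x, cylinder G A T w x ->
   ~ has_periods k (invmul S) (restriction (T := [set` T]) x) >].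
have [||C [cC dC UC]] := @greedy_marker G A k.+1 S _ (enum bad)
    (fun w : {ffun T -> A} => cylinder G A T w) isT S0.
- by move=> w _; exact: clopen_cylinder.
- by move=> w; rewrite mem_enum => /asboolP; exact: cylinder_kfold_disjoint.
(* The set [C] is built in the full shift. Cutting it down to [X] keeps disjointness, and covering
   survives on [X] because [X] is shift-invariant. *)
exists (X `&` C); split.
- exact: clopen_in_setI.
- exact: kfold_disjoint_sub dC.
move=> x Xx; apply: contra_notP => nper.
pose w : {ffun T -> A} := [ffun t => x (\val t)].
have wx : cylinder G A T w x by move=> t; rewrite ffunE.
have [|s sS /image_sigmaP Cx] := UC w _ x wx.
  rewrite mem_enum; apply/asboolP => y wy.
  suff -> : restriction (T := [set` T]) y = restriction (T := [set` T]) x by [].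
  apply/funext => t; have Tt : \val t \in T := set_valP t.
  by rewrite /restriction -[\val t]/(\val [` Tt]%fset) wy wx.
exists s => //; apply/image_sigmaP; split=> //.
by apply: (proj2 hX s^-1%g); exists x.
Qed.
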